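(* Let $\mathcal A=\mathcal B\oplus\mathcal I$ be a commutative Banach algebra that is the semidirect product of a semisimple closed subalgebra $\mathcal B$ and a semisimple closed ideal $\mathcal I$, with elements written as pairs $(b,a)$, $b\in\mathcal B$, $a\in\mathcal I$. Then $T\in M(\mathcal A)$ if and only if there exist $T_{\mathcal I}\in Hom_{\mathcal B}(\mathcal I,\mathcal I)\cap M(\mathcal I)$, $S_{\mathcal I}\in Hom_{\mathcal B}(\mathcal B,\mathcal I)$ and $T_{\mathcal B}\in M(\mathcal B)$ such that $$T_{\mathcal I}(ab)=aS_{\mathcal I}(b)+aT_{\mathcal B}(b)\quad\text{and}\quad T((b,a))=(T_{\mathcal B}(b),\ T_{\mathcal I}(a)+S_{\mathcal I}(b))$$ for all $a\in\mathcal I$ and $b\in\mathcal B$.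
   Context: A Banach algebra $\mathcal A$ is a semidirect product of a closed subalgebra $\mathcal B$ and a closed two-sided ideal $\mathcal I$ of $\mathcal A$ if $\mathcal A=\mathcal B\oplus\mathcal I$ (direct sum of vector spaces). Writing elements as pairs $(b,a)$ with $b\in\mathcal B$, $a\in\mathcal I$ (representing $b+a$), the product is $(b,a)(b',a')=(bb',\,aa'+ba'+ab')$ and the norm is $\|(b,a)\|=\|b\|+\|a\|$. For a Banach algebra $\mathcal C$ and Banach $\mathcal C$-bimodules $X,Y$, $Hom_{\mathcal C}(X,Y)$ is the space of bounded linear left $\mathcal C$-module maps $T:X\to Y$, i.e. $T(c\cdot x)=c\cdot T(x)$ for all $c\in\mathcal C$, $x\in X$. Here $\mathcal B$ and $\mathcal I$ are $\mathcal B$-bimodules via the multiplication of $\mathcal A$. For a commutative Banach algebra $\mathcal C$, $M(\mathcal C)$ is the space of multipliers of $\mathcal C$, i.e. linear operators $T:\mathcal C\to\mathcal C$ with $cT(b)=T(c)b$ for all $b,c\in\mathcal C$. *)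

(* Defs.v *)
From HB Require Import structures.
From mathcomp Require Import all_boot all_order all_algebra.
From mathcomp Require Import complex.
From mathcomp Require Import boolp classical_sets functions reals topology normedtype.

Set Implicit Arguments.
Unset Strict Implicit.
Unset Printing Implicit Defensive.

Import Order.TTheory GRing.Theory Num.Theory.
Import numFieldNormedType.Exports.

Local Open Scope classical_set_scope.
Local Open Scope ring_scope.

(* Banach algebras are not assumed to have a unit (the ring structures of
   ssralg all have one), and neither are their subalgebras and ideals. *)
HB.mixin Record CompleteNormedModule_isBanachAlgebra (K : numFieldType) A
    & CompleteNormedModule K A := {
  bmul : A -> A -> A;
  bmulA : associative bmul;
  bmulDl : left_distributive bmul +%R;
  bmulDr : right_distributive bmul +%R;
  bscalerAl : forall (k : K) (x y : A), k *: bmul x y = bmul (k *: x) y;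
  bscalerAr : forall (k : K) (x y : A), k *: bmul x y = bmul x (k *: y);
  ler_norm_bmul : forall x y : A, `|bmul x y| <= `|x| * `|y| }.

#[short(type="banachAlgType")]
HB.structure Definition BanachAlgebra (K : numFieldType) :=
  {A of CompleteNormedModule K A & CompleteNormedModule_isBanachAlgebra K A}.

Declare Scope banach_scope.
Infix "**" := bmul (at level 40, left associativity) : banach_scope.
Local Open Scope banach_scope.

(* Subalgebras and ideals are sets of elements of an ambient algebra A, and the
   notions below are relative to such a set C, regarded as an algebra in its own
   right; C := setT gives the notions for A itself.  An operator X -> Y is a
   function A -> A sending X into Y, whose values outside X are irrelevant. *)
Section BanachAlgebra.
Context {K : numFieldType} {A : banachAlgType K}.
Implicit Types (B C I L M X Y : set A) (T : A -> A).

Definition subspace_of X Y :=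
  [/\ X `<=` Y, X 0 & forall (k : K) x y, X x -> X y -> X (k *: x + y)].

Definition closed_subalgebra B :=
  [/\ closed B, subspace_of B setT & forall x y, B x -> B y -> B (x ** y)].

Definition closed_ideal I :=
  [/\ closed I, subspace_of I setT &
      forall c x, I x -> I (c ** x) /\ I (x ** c)].

(* The pair (b, a) is encoded as b + a; the usual product of pairs
   (b b', a a' + b a' + a b') is then the product of A. *)
Definition semidirect_product B I :=
  [/\ closed_subalgebra B, closed_ideal I,
      (forall x, exists b a, [/\ B b, I a & x = b + a]),
      B `&` I = [set 0] &
      forall b a, B b -> I a -> `|b + a| = `|b| + `|a|].

Definition left_ideal C L :=
  subspace_of L C /\ forall c x, C c -> L x -> L (c ** x).

(* Modularity replaces the unit: C has a right unit e modulo L. *)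
Definition modular C L := exists2 e, C e & forall x, C x -> L (x - x ** e).

Definition maximal_left_ideal C M :=
  [/\ left_ideal C M, M <> C &
      forall L, left_ideal C L -> M `<=` L -> L = M \/ L = C].

Definition jacobson_radical C : set A :=
  [set x | C x /\ forall M, maximal_left_ideal C M -> modular C M -> M x].

Definition semisimple C := jacobson_radical C = [set 0].

Definition linear_on X Y T :=
  (forall x, X x -> Y (T x)) /\
  (forall (k : K) x y, X x -> X y -> T (k *: x + y) = k *: T x + T y).

Definition bounded_on X T :=
  exists r : K, forall x, X x -> `|T x| <= r * `|x|.

Definition module_hom C X Y : set (A -> A) :=
  [set T | [/\ linear_on X Y T, bounded_on X T &
               forall c x, C c -> X x -> T (c ** x) = c ** T x]].

Definition multipliers C : set (A -> A) :=
  [set T | linear_on C C T /\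
           forall b c, C b -> C c -> c ** T b = T c ** b].

End BanachAlgebra.

(* Main.v *)
Require Import Defs.
From HB Require Import structures.
From mathcomp Require Import all_boot all_order all_algebra.
From mathcomp Require Import complex.
From mathcomp Require Import boolp classical_sets functions reals topology normedtype.
From mathcomp Require Import ring.
Import Order.POrderTheory.
Import GRing.Theory Num.Theory numFieldNormedType.Exports.
Local Open Scope classical_set_scope.
Local Open Scope complex_scope.
Local Open Scope ring_scope.
Local Open Scope banach_scope.

(** The algebra A is faithful: y A = 0 forces y = 0.  Indeed an element of B
    or of I that annihilates B or I lies in every modular maximal left ideal
    M, since x = x - x e belongs to M when e is a right unit modulo M; so it
    lies in the radical, which is 0.  Comparing components in A = B + I gives
    the property for A.

    Faithfulness is what makes a multiplier T a bounded module map.  Identities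
    between values of T can be tested after multiplication by an arbitrary d,
    where d T(x) = T(d) x; this gives T(cx) = c T(x), and shows that the graph
    of T is the set of the (x, y) with c y = T(c) x for all c, an intersection
    of closed sets.  Boundedness then follows from the closed graph theorem.

    It remains to split T along A = B + I.  It maps I into I: if b is the
    B-component of T(a) with a in I, then for c in B the product c b is the
    B-component of c T(a) = T(c) a, an element of I, so b annihilates B and
    vanishes.  Put T_I := T on I, and let T_B, S_I be the two components of T
    on B.  The projections of A on B and I commute with multiplication by
    elements of B, so every required identity is a component of an identity
    for T, and S_I is bounded because |S_I b| <= |T b| for the sum norm.

    Conversely, expand (b + a) T(b' + a'): the four kinds of terms are each
    symmetric under the exchange of (b, a) and (b', a'), the mixed ones because
    b T_I(a') = T_I(a' b) = a' S_I(b) + a' T_B(b).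

    The closed graph theorem is proved over an arbitrary Archimedean field of
    scalars, so that it covers R[i], by the usual route: Baire's theorem
    bounds T on a dense part of some ball, and successive approximation turns
    this into a bound on T x for every x. *)

(** * Fast Cauchy sequences *)

Lemma halving_lt {K : numFieldType} (archiK : Num.archimedean_axiom K)
    (r : nat -> K) (e : K) :
  (forall n, 0 <= r n) -> (forall n, 2 * r n.+1 <= r n) -> 0 < e ->
  \forall n \near \oo, r n < e.
Proof.
move=> r0 rS e0; have [N rN] := archiK (r 0 / e); exists N => // n /= Nn.
have rX m : 2 ^+ m * r m <= r 0.
  elim: m => [|m IH]; first by rewrite expr0 mul1r.
  by apply: le_trans IH; rewrite exprSr -mulrA ler_wpM2l ?exprn_ge0.
rewrite ger0_norm ?divr_ge0 ?(ltW e0)// ltr_pdivrMr// in rN.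
rewrite -(@ltr_pM2l _ (2 ^+ n)) ?exprn_gt0//.
apply: le_lt_trans (rX n) _.
apply: lt_le_trans rN _.
by rewrite ler_pM2r// -natrX ler_nat (leq_trans Nn)// ltnW// ltn_expl.
Qed.

(** Both completeness arguments below, the nested balls of Baire's theorem and
    the successive approximations of the closed graph theorem, produce steps
    bounded by radii that are at least halved each time; the point is the
    bound on the distance to the limit from each stage. *)
Lemma halving_cvg {K : numFieldType} (archiK : Num.archimedean_axiom K)
    {V : completeNormedModType K} (x : nat -> V) (r : nat -> K) :
  (forall n, 2 * r n.+1 <= r n) -> (forall n, `|x n.+1 - x n| <= r n) ->
  exists2 l, x @ \oo --> l & forall n, `|l - x n| <= 2 * r n.
Proof.
move=> rS xS.
have r0 n : 0 <= r n by apply: le_trans (xS n).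
(* Keeping the - 2 r (k + n) lets the induction absorb the next step. *)
have tail n k : `|x (k + n)%N - x n| <= 2 * r n - 2 * r (k + n)%N.
  elim: k => [|k IH]; first by rewrite !subrr normr0.
  rewrite -(subrK (x (k + n)%N) (x (k.+1 + n)%N)) -addrA.
  apply: le_trans (ler_normD _ _) _.
  apply: le_trans (lerD (xS _) IH) _.
  rewrite addrCA lerD2l lerBlDr addrC lerBrDr [leRHS]mulr_natl mulr2n lerD2l.
  exact: rS.
have tail2 n m : (n <= m)%N -> `|x m - x n| <= 2 * r n.
  move=> nm; rewrite -(subnK nm); apply: le_trans (tail _ _) _.
  by rewrite gerBl mulr_ge0.
have : cvg (x @ \oo).
  apply: cauchy_cvg; apply: cauchy_exP => e e0.
  have e20 : 0 < e / 2 by rewrite divr_gt0.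
  have [n _ /(_ n (leqnn n)) rn] := halving_lt archiK _ _ r0 rS e20.
  exists (x n), n => // m /= nm; rewrite -ball_normE /ball_ /= distrC.
  apply: le_lt_trans (tail2 _ _ nm) _.
  by rewrite -ltr_pdivlMl// mulrC.
move=> /cvg_ex[/= l xl]; exists l => // n.
rewrite real_leNgt ?realM ?realn ?ger0_real//; apply/negP => lt.
have e0 : 0 < `|l - x n| - 2 * r n by rewrite subr_gt0.
have [m _ xm] := cvgr_dist_lt _ _ xl _ e0.
have := xm (maxn m n) (leq_maxl _ _) => /=.
rewrite ltrBrDr => /lt_geF/negP; apply.
by apply: le_trans (ler_distD (x (maxn m n)) _ _) _; rewrite lerD2l tail2// leq_maxr.
Qed.

(** * The closed graph theorem *)

(** Baire's theorem, in the form in which the sets of the cover need not be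
    closed.  If no closure had an interior point, any ball could be shrunk to
    one that misses the n-th set, and the common point of these balls would
    not be covered. *)
Lemma baire_cover {K : numFieldType} (archiK : Num.archimedean_axiom K)
    {V : completeNormedModType K} (F : nat -> set V) :
  (forall x, exists n, F n x) -> exists n, (closure (F n))° !=set0.
Proof.
move=> cover; apply: contrapT => /forallNP noint.
have step (p : nat * (V * K)) : exists q : V * K, 0 < p.2.2 ->
    [/\ 0 < q.2, 2 * q.2 <= p.2.2, `|q.1 - p.2.1| <= p.2.2 &
        forall y, F p.1 y -> ~ `|q.1 - y| <= 2 * q.2].
  case: p => n [x r] /=.
  case: (pselect (0 < r)) => [r0|nr0]; last by exists (x, 0) => /nr0.
  have [x' [xx' nx']] : exists x', `|x' - x| < r /\ ~ closure (F n) x'.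
    apply: contrapT => /forallNP H; apply: (noint n); exists x.
    apply/nbhs_normP; exists r => //= y xy; apply: contrapT => ny.
    by apply: (H y); split=> //; rewrite distrC.
  have [B [Bx' FB]] : exists B, nbhs x' B /\ ~ (F n `&` B !=set0).
    apply: contrapT => /forallNP H; apply: nx' => B Bx'.
    by apply: contrapT => FB; apply: (H B).
  have [s /= s0 sB] := (nbhs_normP _ _).1 Bx'.
  have [t [t0 tr ts]] : exists t, [/\ 0 < t, 2 * t <= r & 2 * t < s].
    exists ((if r <= s then r else s) / 2 / 2); rewrite ![2 * _]mulrC divfK ?pnatr_eq0//.
    have half (z : K) : 0 < z -> z / 2 < z.
      by move=> z0; rewrite ltr_pdivrMr// ltr_pMr// ltr1n.
    case: ifP => rs; rewrite ?divr_gt0//; split=> //.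
    - exact/ltW/half.
    - exact: lt_le_trans (half _ r0) rs.
    - apply: le_trans (ltW (half _ s0)) _.
      by have := real_leVge (gtr0_real r0) (gtr0_real s0); rewrite rs.
    - exact: half.
  exists (x', t) => _; split=> //=; try exact: ltW.
  move=> y Fy x'y; apply: FB; exists y; split=> //; apply: sB => /=.
  exact: le_lt_trans ts.
have [f fP] := choice step.
(* q n.+1 is a centre x with a radius t such that the ball of radius 2 t about
   x misses F n; the limit of the centres stays in all of these balls. *)
pose fix q n : V * K := if n is m.+1 then f (m, q m) else (0, 1).
have q0 n : 0 < (q n).2 by elim: n => //= n IH; case: (fP (n, q n) IH).
have [l _ lq] := halving_cvg archiK (fun n => (q n).1) (fun n => (q n).2)
  (fun n => let: And4 _ h _ _ := fP (n, q n) (q0 n) in h)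
  (fun n => let: And4 _ _ h _ := fP (n, q n) (q0 n) in h).
have [n Fnl] := cover l.
have [_ _ _] := fP (n, q n) (q0 n); move/(_ _ Fnl); apply.
by rewrite distrC; exact: (lq n.+1).
Qed.

(** The sets of the x with |T x| <= n cover V, so one of them is dense in some
    ball.  By linearity every x is approximated within |x| / 2 by some y with
    |T y| <= C |x|; iterating on the remainder writes x as the limit of partial
    sums whose images also converge, to a vector of norm at most 2 C |x|, and
    closedness of the graph says that this vector is T x. *)
Lemma closed_graph {K : numFieldType} (archiK : Num.archimedean_axiom K)
    {V W : completeNormedModType K} (T : {linear V -> W}) :
  closed [set p : V * W | p.2 = T p.1] ->
  exists r : K, forall x, `|T x| <= r * `|x|.
Proof.
move=> closedT.
have [n [x0 /nbhs_normP[r /= r0 x0r]]] :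
    exists n, (closure [set x : V | `|T x| <= n%:R])° !=set0.
  apply: baire_cover => // x; have [n xn] := archiK `|T x|.
  by exists n; rewrite /= ltW// -(normr_id (T x)).
(* Differences of approximants move the ball from x0 to the origin. *)
have near0 x e : `|x| < r -> 0 < e ->
    exists2 y, `|T y| <= 2 * n%:R & `|x - y| < e.
  move=> xr e0; have e20 : 0 < e / 2 by rewrite divr_gt0.
  have [y1 [/= Ty1 y1x]] : [set y | `|T y| <= n%:R] `&` ball (x0 + x) (e / 2) !=set0.
    apply: (x0r (x0 + x)); last exact: nbhsx_ballx.
    by rewrite /= opprD addNKr normrN.
  have [y2 [/= Ty2 y2x]] : [set y | `|T y| <= n%:R] `&` ball x0 (e / 2) !=set0.
    by apply: (x0r x0); [rewrite /= subrr normr0|exact: nbhsx_ballx].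
  exists (y1 - y2).
    rewrite linearB mulr_natl mulr2n.
    by apply: le_trans (ler_normB _ _) _; exact: lerD.
  rewrite -ball_normE /= in y1x y2x.
  have -> : x - (y1 - y2) = (x0 + x - y1) - (x0 - y2).
    rewrite !opprB [x0 + x]addrC -!addrA; congr (_ + _).
    by rewrite [RHS]addrC !addrA subrK addrC.
  by apply: le_lt_trans (ler_normB _ _) _; rewrite [e]splitr ltrD.
pose C : K := 2 * n%:R * 2 / r.
have approx x : exists y, `|T y| <= C * `|x| /\ 2 * `|x - y| <= `|x|.
  have [->|x0'] := eqVneq x 0.
    by exists 0; rewrite linear0 subr0 !normr0 !mulr0.
  have nx : 0 < `|x| by rewrite normr_gt0.
  pose k := 2 * `|x| / r.
  have k0 : 0 < k by rewrite divr_gt0 ?mulr_gt0.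
  have kx : `|k^-1 *: x| = r / 2.
    by rewrite normrZ gtr0_norm ?invr_gt0// /k; field; rewrite !gt_eqF.
  have [||y Ty xy] := near0 (k^-1 *: x) (r / 2 / 2).
  - by rewrite kx ltr_pdivrMr// ltr_pMr// ltr1n.
  - by rewrite !divr_gt0.
  exists (k *: y); split.
    rewrite linearZ normrZ gtr0_norm//.
    have -> : C * `|x| = k * (2 * n%:R).
      by rewrite /C /k; ring.
    by rewrite ler_pM2l.
  have -> : x - k *: y = k *: (k^-1 *: x - y).
    by rewrite scalerBr scalerA mulfV ?gt_eqF// scale1r.
  rewrite normrZ gtr0_norm//.
  apply: le_trans (ler_wpM2l _ (ler_wpM2l _ (ltW xy))) _ => //; first exact: ltW.
  rewrite le_eqVlt; apply/orP; left; apply/eqP; rewrite /k; field.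
  by rewrite gt_eqF.
have [f fP] := choice approx.
exists (2 * C) => x.
(* z m is what remains of x after m approximations. *)
pose z := fix z n := if n is m.+1 then z m - f (z m) else x.
have zS m : 2 * `|z m.+1| <= `|z m| by have [] := fP (z m).
have C0 : 0 <= C by rewrite !mulr_ge0// invr_ge0 ltW.
have [| |l Tl /(_ 0)] := halving_cvg archiK (fun m => T (x - z m))
  (fun m => C * `|z m|).
- by move=> m; rewrite mulrCA ler_wpM2l.
- move=> m; rewrite -linearB; have -> : x - z m.+1 - (x - z m) = f (z m).
    move=> /=; move: (z m) => y.
    by rewrite !opprB [LHS]addrC addrA subrK addrC subrK.
  by have [] := fP (z m).
rewrite /= subrr linear0 subr0 mulrA => lx.
suff <- : l = T x by [].
have zx : x - z m @[m --> \oo] --> x.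
  apply/cvgrPdist_lt => e e0.
  by near do rewrite subKr; exact: halving_lt.
apply: (@closed_cvg _ (V * W)%type \oo _ (fun m => (x - z m, T (x - z m)))
  [set p : V * W | p.2 = T p.1] closedT _ (x, l)).
- exact: nearW.
- exact: (cvg_pair zx Tl).
Unshelve. all: by end_near. Qed.

(** * Multiplication and multipliers in a Banach algebra *)

(** Lets the generic lemmas on linear maps apply to the second argument of the
    product. *)
HB.instance Definition _ (K : numFieldType) (A : banachAlgType K) (c : A) :=
  GRing.isLinear.Build K A A *:%R (bmul c)
    (fun k x y => etrans (bmulDr c (k *: x) y)
                    (congr1 (+%R^~ (c ** y)) (esym (bscalerAr k c x)))).

(** The Archimedean structure of R bounds norms in R[i], since these are real;
    this is how the closed graph theorem applies to complex scalars. *)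
Lemma complex_archimedean (R : realType) : Num.archimedean_axiom R[i].
Proof.
move=> x; exists (Num.truncn (complex.Re `|x|)).+1.
have /complex_realP[r ->] := normr_real x.
by rewrite -(rmorph_nat (real_complex R)) ltcR truncnS_gt.
Qed.

Lemma bmul_continuous {K : numFieldType} {A : banachAlgType K} (c : A) :
  continuous (bmul c).
Proof.
apply: bounded_linear_continuous; apply/linear_boundedP.
exists `|c|; split=> [|r cr x]; first exact: normr_real.
exact: le_trans (ler_norm_bmul _ _) (ler_wpM2r _ (ltW cr)).
Qed.

Definition faithful {K : numFieldType} (A : banachAlgType K) :=
  forall y : A, (forall c, c ** y = 0) -> y = 0.

(** By faithfulness, y = T x if and only if c y = c T x = T c x for all c, and
    each of these conditions is closed in (x, y). *)
Lemma multiplier_graph_closed {K : numFieldType} {A : banachAlgType K}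
    {T : A -> A} :
  faithful A -> multipliers setT T -> closed [set p : A * A | p.2 = T p.1].
Proof.
move=> faithA [_ TM].
have -> : [set p : A * A | p.2 = T p.1] =
    \bigcap_(c : A) (fun p : A * A => c ** p.2 - T c ** p.1) @^-1` [set 0].
  apply/seteqP; split=> [p /= pT c _ /=|p pT]; first by rewrite pT TM ?subrr.
  apply/eqP; rewrite -subr_eq0; apply/eqP/faithA => c.
  by rewrite linearB /= TM//; exact: pT.
apply: closed_bigI => c _; apply: preimage_closed; last first.
  exact: accessible_closed_set1 (hausdorff_accessible (@norm_hausdorff _ _)) _.
move=> p _; apply: cvgB; apply: continuous_comp; try exact: bmul_continuous.
- exact: cvg_snd.
- exact: cvg_fst.
Qed.

(** The identity T (c b) = c T b is tested after multiplication by d: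
    d T (c b) = T d c b = d T c b = d c T b. *)
Lemma multiplier_module_hom {K : numFieldType}
    (archiK : Num.archimedean_axiom K) {A : banachAlgType K} {T : A -> A} :
  faithful A -> multipliers setT T -> module_hom setT setT setT T.
Proof.
move=> faithA MT; have [[_ Tlin] TM] := MT; split.
- by split=> // k x y _ _; exact: Tlin.
- pose T' : {linear A -> A} := HB.pack T
    (GRing.isLinear.Build K A A *:%R T (fun k x y => Tlin k x y Logic.I Logic.I)).
  have [r Tr] := closed_graph archiK T'
    (multiplier_graph_closed faithA MT).
  by exists r => x _; exact: Tr.
- move=> c b _ _; apply/eqP; rewrite -subr_eq0; apply/eqP/faithA => d.
  by rewrite linearB /= TM// !bmulA -TM// -!bmulA -TM// subrr.
Qed.

(** * Semisimple algebras and semidirect products *)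

(** For a modular ideal M with right unit e modulo M, x = x - x e lies in M. *)
Lemma semisimple_annihilator {K : numFieldType} {A : banachAlgType K}
    {C : set A} {x : A} :
  semisimple C -> C x -> (forall c, C c -> x ** c = 0) -> x = 0.
Proof.
move=> ssC Cx xC; suff : jacobson_radical C x by rewrite ssC.
by split=> // M _ [e Ce /(_ x Cx)]; rewrite xC// subr0.
Qed.

Lemma subspaceB {K : numFieldType} {A : banachAlgType K} {X Y : set A} {x y} :
  subspace_of X Y -> X x -> X y -> X (x - y).
Proof.
by move=> [_ _ XL] Xx Xy; rewrite addrC -scaleN1r; exact: XL.
Qed.

Lemma semidirect_unique {K : numFieldType} {A : banachAlgType K}
    {B I : set A} (b a b' a' : A) :
  semidirect_product B I -> B b -> I a -> B b' -> I a' ->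
  b + a = b' + a' -> b = b' /\ a = a'.
Proof.
move=> [[_ sB _] [_ sI _] _ BI0 _] Bb Ia Bb' Ia' e.
have bb' : b - b' = a' - a.
  by apply/eqP; rewrite subr_eq addrAC [a' + _]addrC -e addrK.
suff b0 : b - b' = 0.
  by split; apply/eqP; rewrite -subr_eq0 ?b0// -opprB -bb' b0 oppr0.
suff : (B `&` I) (b - b') by rewrite BI0.
by split; [|rewrite bb']; [exact: subspaceB sB _ _|exact: subspaceB sI _ _].
Qed.

(** If b + a annihilates A then b annihilates B, because c b is the B-component
    of c (b + a) for c in B; so b = 0, and a annihilates I. *)
Lemma semidirect_faithful {K : numFieldType} {A : banachAlgType K}
    (mulC : commutative (@bmul K A)) {B I : set A} :
  semidirect_product B I -> semisimple B -> semisimple I -> faithful A.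
Proof.
move=> AeqBI ssB ssI y cy0.
have [[_ [_ B0 _] BM] [_ [_ I0 _] IM] dec _ _] := AeqBI.
have [b [a [Bb Ia ye]]] := dec y.
have b0 : b = 0.
  apply: (semisimple_annihilator ssB Bb) => c Bc; rewrite mulC.
  apply: proj1 (semidirect_unique _ (c ** a) 0 0 AeqBI _ _ _ _ _) => //.
  - exact: BM.
  - exact: (IM _ _ Ia).1.
  - by rewrite -linearD /= -ye cy0 addr0.
rewrite ye b0 add0r; apply: (semisimple_annihilator ssI Ia) => c _.
by rewrite mulC -(cy0 c) ye b0 add0r.
Qed.

(** For a in I and c in B, c T(a) = T(c) a is in I, so the B-component of T(a)
    annihilates B. *)
Lemma multiplier_ideal {K : numFieldType} {A : banachAlgType K}
    (mulC : commutative (@bmul K A)) {B I : set A} {T : A -> A} {a : A} :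
  semidirect_product B I -> semisimple B -> multipliers setT T ->
  I a -> I (T a).
Proof.
move=> AeqBI ssB [_ TM] Ia.
have [[_ [_ B0 _] BM] [_ _ IM] dec _ _] := AeqBI.
have [b [a' [Bb Ia' Ta]]] := dec (T a).
suff -> : T a = a' by [].
rewrite Ta (_ : b = 0) ?add0r//.
apply: (semisimple_annihilator ssB Bb) => c Bc; rewrite mulC.
apply: proj1 (semidirect_unique _ (c ** a') 0 (T c ** a) AeqBI _ _ _ _ _) => //.
- exact: BM.
- exact: (IM _ _ Ia').1.
- exact: (IM _ _ Ia).1.
- by rewrite -linearD /= -Ta add0r TM.
Qed.

(** * The multipliers of a semidirect product *)

Theorem corollary3p1 (R : realType) (A : banachAlgType R[i])
    (mulC : commutative (@bmul R[i] A)) (B I : set A)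
    (AeqBI : semidirect_product B I)
    (ssB : semisimple B) (ssI : semisimple I) (T : A -> A) :
  multipliers setT T <->
  exists T_I S_I T_B : A -> A,
    [/\ (module_hom B I I `&` multipliers I) T_I,
        module_hom B B I S_I,
        multipliers B T_B,
        forall a b, I a -> B b -> T_I (a ** b) = a ** S_I b + a ** T_B b &
        forall a b, I a -> B b -> T (b + a) = T_B b + (T_I a + S_I b)].
Proof.
have [[_ [_ B0 BL] BM] [_ [_ I0 IL] IM] dec _ normD] := AeqBI.
have uniq b a b' a' := semidirect_unique b a b' a' AeqBI.
split=> [MT|[T_I [S_I [T_B [[[[T_II T_IL] _ T_IH] [_ T_IM]]
    [[S_II S_IL] _ S_IH] [[T_BB T_BL] T_BM] T_Iab TE]]]]]; last first.
  split.
    split=> // k x y _ _.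
    have [b [a [Bb Ia ->]]] := dec x; have [b' [a' [Bb' Ia' ->]]] := dec y.
    rewrite scalerDr addrACA !TE//; [|exact: IL|exact: BL].
    rewrite T_BL// T_IL// S_IL// !scalerDr !addrA.
    by rewrite [LHS](ACl (1*3*5*2*4*6))%AC.
  move=> x y _ _.
  have [b [a [Bb Ia ->]]] := dec y; have [b' [a' [Bb' Ia' ->]]] := dec x.
  rewrite !TE// [RHS]mulC !bmulDl !linearD /=.
  have BB : b ** T_B b' = b' ** T_B b by rewrite T_BM// mulC.
  have II : a ** T_I a' = a' ** T_I a by rewrite T_IM// mulC.
  have SS : b ** S_I b' = b' ** S_I b by rewrite -!S_IH// mulC.
  (* Every mixed term is brought to the form coming from T_I (a b). *)
  have BI : b ** T_I a' = a' ** S_I b + a' ** T_B b.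
    by rewrite -T_IH// mulC T_Iab.
  have BI' : b' ** T_I a = a ** S_I b' + a ** T_B b'.
    by rewrite -T_IH// mulC T_Iab.
  rewrite BB II SS BI BI' !addrA.
  by rewrite [LHS](ACl (1*7*5*4*3*6*2))%AC.
have faithA := semidirect_faithful mulC AeqBI ssB ssI.
have [[_ Tlin] [r Tr] TH] :=
  multiplier_module_hom (@complex_archimedean R) faithA MT.
have TI a : I a -> I (T a) := multiplier_ideal mulC AeqBI ssB MT.
have TM := MT.2.
have decp x : exists p, [/\ B p.1, I p.2 & x = p.1 + p.2].
  by have [b [a ?]] := dec x; exists (b, a).
have [p /all_and3[pB pI pE]] := choice decp.
have TL k x y : T (k *: x + y) = k *: T x + T y by exact: Tlin.
have pL k x y : (p (k *: x + y)).1 = k *: (p x).1 + (p y).1 /\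
    (p (k *: x + y)).2 = k *: (p x).2 + (p y).2.
  apply: uniq => //; [exact: BL|exact: IL|].
  by rewrite -pE {1}(pE x) {1}(pE y) scalerDr addrACA.
have pM c x : B c -> (p (c ** x)).1 = c ** (p x).1 /\
    (p (c ** x)).2 = c ** (p x).2.
  move=> Bc; apply: uniq => //; [exact: BM|exact: (IM _ _ (pI x)).1|].
  by rewrite -linearD /= -!pE.
exists T, (fun b => (p (T b)).2), (fun b => (p (T b)).1); split.
- split; split.
  + by split=> // k x y _ _; exact: TL.
  + by exists r => x _; exact: Tr.
  + by move=> c x _ _; exact: TH.
  + by split=> // k x y _ _; exact: TL.
  + by move=> b c _ _; exact: TM.
- split.
  + by split=> // k x y _ _; rewrite TL (pL _ _ _).2.
  + exists r => b _; apply: le_trans (Tr b Logic.I).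
    by rewrite {2}(pE (T b)) normD// lerDr.
  + by move=> c b Bc Bb; rewrite TH// (pM _ _ _).2.
- split; first by split=> // k x y _ _; rewrite TL (pL _ _ _).1.
  move=> b c Bb Bc.
  by rewrite -(pM _ _ Bc).1 TM// [T c ** b]mulC [RHS]mulC (pM _ _ Bb).1.
- by move=> a b Ia Bb; rewrite TH// addrC -linearD /= -pE.
- by move=> a b Ia Bb; rewrite addrC -[a]scale1r TL !scale1r addrCA -pE.
Qed.
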